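(* There exists a permutation array $P\subset[3]^7$ which is realized by seven complete flags in $\mathbb{F}_2^3$, but which is not realized by any seven complete flags in $K^3$ for any field $K$ of characteristic different from $2$. In particular $P$ is not realizable over $\mathbb{C}$.
   Context: A complete flag in $K^n$ is a chain $E_\bullet=\{0=E_0\subset E_1\subset\cdots\subset E_n=K^n\}$ with $\dim E_i=i$. Let $[n]=\{1,\dots,n\}$. For $x,y\in[n]^d$ write $x\preceq y$ if $x_i\le y_i$ for all $i$; $\bigvee R$ is the coordinatewise maximum of a set $R$. A dot array is a subset $P\subset[n]^d$; $P[y]=\{x\in P:x\preceq y\}$. Put $\mathrm{rk}_jP=\#\{k\in[n]:\exists x\in P,\ x_j=k\}$. $P$ is rankable of rank $r$, written $\mathrm{rk}\,P=r$, if $\mathrm{rk}_jP=r$ for all $j$; it is totally rankable if every $P[y]$ is rankable. A position $x$ is redundant in $P$ if there is $R\subset P$ with $x=\bigvee R$, $\#R>1$, and every $y\in R$ has some coordinate $y_i=x_i$. A permutation array in $[n]^d$ is a totally rankable dot array of rank $n$ no element of which is redundant. A permutation array $P\subset[n]^d$ is realized over $K$ by complete flags $E^1_\bullet,\dots,E^d_\bullet$ in $K^n$ if $\dim(E^1_{x_1}\cap\cdots\cap E^d_{x_d})=\mathrm{rk}\,P[x]$ for all $x\in[n]^d$. *)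

(* Defs.v *)
From mathcomp Require Import all_boot all_order all_algebra.
From mathcomp Require Import reals complex.

Set Implicit Arguments.
Unset Strict Implicit.
Unset Printing Implicit Defensive.

Import Order.TTheory GRing.Theory Num.Theory.

Local Open Scope nat_scope.

(* Coordinates are 0-based: k : 'I_n stands for the element k + 1 of [n].     *)
Definition position (n d : nat) := {ffun 'I_d -> 'I_n}.

Definition preceq (n d : nat) (x y : position n d) : bool :=
  [forall i, x i <= y i].

Definition below (n d : nat) (P : {set position n d}) (y : position n d) :
    {set position n d} :=
  [set x in P | preceq x y].

Definition rk_coord (n d : nat) (P : {set position n d}) (j : 'I_d) : nat :=
  #|[set k : 'I_n | [exists x in P, x j == k]]|.

(* rk P = r, as a relation: rk P exists only when P is rankable, and it is    *)
(* then unique provided 0 < d.                                                *)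
Definition has_rank (n d : nat) (P : {set position n d}) (r : nat) : Prop :=
  forall j : 'I_d, rk_coord P j = r.

Definition rankable (n d : nat) (P : {set position n d}) : Prop :=
  exists r : nat, has_rank P r.

Definition totally_rankable (n d : nat) (P : {set position n d}) : Prop :=
  forall y : position n d, rankable (below P y).

(* x is the coordinatewise maximum of R. The value 0 of an empty \max is      *)
(* irrelevant below, where R has at least two elements.                       *)
Definition is_join (n d : nat) (R : {set position n d}) (x : position n d) :
    Prop :=
  forall i : 'I_d, nat_of_ord (x i) = \max_(y in R) nat_of_ord (y i).

Definition redundant (n d : nat) (P : {set position n d}) (x : position n d) :
    Prop :=
  exists R : {set position n d},
    [/\ R \subset P, is_join R x, 1 < #|R|
      & forall y, y \in R -> exists i : 'I_d, y i = x i].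

Definition permutation_array (n d : nat) (P : {set position n d}) : Prop :=
  [/\ totally_rankable P, has_rank P n
    & forall x, x \in P -> ~ redundant P x].

Definition complete_flag (K : fieldType) (n : nat)
    (E : 'I_n.+1 -> {vspace 'rV[K]_n}) : Prop :=
  (forall i j : 'I_n.+1, i <= j -> (E i <= E j)%VS) /\
  (forall i : 'I_n.+1, \dim (E i) = i).

(* lift ord0 : 'I_n -> 'I_n.+1 has value k + 1 at k, so it turns the 0-based  *)
(* coordinate x i into the index of the corresponding step of the flag E i.   *)
Definition realized_by (K : fieldType) (n d : nat) (P : {set position n d})
    (E : 'I_d -> 'I_n.+1 -> {vspace 'rV[K]_n}) : Prop :=
  (forall i : 'I_d, complete_flag (E i)) /\
  (forall x : position n d,
     has_rank (below P x) (\dim (\bigcap_(i < d) E i (lift ord0 (x i)))%VS)).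

Definition realizable (K : fieldType) (n d : nat) (P : {set position n d}) :
    Prop :=
  exists E : 'I_d -> 'I_n.+1 -> {vspace 'rV[K]_n}, realized_by P E.

(* Main.v *)
Require Import Defs.
From mathcomp Require Import all_boot all_order all_algebra.
From mathcomp Require Import reals complex.

Set Implicit Arguments.
Unset Strict Implicit.
Unset Printing Implicit Defensive.

Import GRing.Theory Num.Theory.

Local Open Scope ring_scope.

(** The array is the one attached to the Fano plane.  Write the points of the
    projective plane over F_2 as p_0, ..., p_6, where p_i is the i-th power of
    a root a of X^3 + X + 1 in F_8.  Since 1 + a = a^3, the lines are
    l_i = {p_i, p_(i+1), p_(i+3)} with indices mod 7, and (p_i, l_i) is a
    complete flag E^i.

    Over a finite field K, a nonzero vector v has a position: its i-th
    coordinate is the step at which v enters the flag E^i.  Let P be the set of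
    the positions of all nonzero vectors (vector_array).  The j-th coordinates
    of the elements of P[x] are the steps at which the flag E^j meets the
    subspace V = E^1_(x_1) :&: ... :&: E^d_(x_d) in a larger space than before,
    and there are dim V of them (card_jumps).  So P is totally rankable and
    realized by E.  If every vector lies in the line E^j_1 of some flag, then
    any y in P with y_j = x_j = 1 comes from a multiple of the vector of x, so
    that y = x, and nothing is redundant.  The seven flags above satisfy this,
    because every nonzero vector of F_2^3 is a p_i.

    Conversely, suppose that P is realized over K by flags with points A_i and
    lines L_i.  Positions which are maximal outside two coordinates show that
    dim (A_j :&: L_i) is the same as over F_2, so A_j lies on L_i exactly when
    p_j lies on l_i.  Such a Fano configuration forces 2 = 0 (fano_char2): the
    classical fact that the diagonal points of a complete quadrangle are
    collinear only in characteristic 2. *)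

(** * Jumps of a complete flag *)

Section Jumps.

Variables (K : fieldType) (n : nat).
Implicit Types (V : {vspace 'rV[K]_n}) (v : 'rV[K]_n).

(** lift ord_max k : 'I_n.+1 has value k, so the jump is the step from F_k to
    F_(k+1). *)
Definition jump (F : 'I_n.+1 -> {vspace 'rV[K]_n}) v (k : 'I_n) : bool :=
  (v \in F (lift ord0 k)) && (v \notin F (lift ord_max k)).

Variable F : 'I_n.+1 -> {vspace 'rV[K]_n}.
Hypothesis flagF : complete_flag F.

Lemma flag0 : F ord0 = 0%VS.
Proof. by apply/eqP; rewrite -dimv_eq0 flagF.2. Qed.

Lemma flag_max : F ord_max = fullv.
Proof. by apply/eqP; rewrite eqEdim subvf flagF.2 dimvf /dim /= mul1n leqnn. Qed.

Lemma jump_neq0 v k : jump F v k -> v != 0.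
Proof. by case/andP=> _; apply: contraNneq => ->; rewrite mem0v. Qed.

Lemma jump_le v (k m : 'I_n) : jump F v k -> v \in F (lift ord0 m) -> (k <= m)%N.
Proof.
case/andP=> _ vNk vm; rewrite leqNgt; apply: contra vNk => lt_mk.
by apply: subvP vm; apply: flagF.1; rewrite lift0 lift_max.
Qed.

Lemma jump_inj v k m : jump F v k -> jump F v m -> k = m.
Proof.
move=> jk jm; apply/val_inj/anti_leq; apply/andP.
by split; [apply: jump_le jk _ | apply: jump_le jm _];
   [case/andP: jm | case/andP: jk].
Qed.

Lemma jump_exists v : v != 0 -> exists k, jump F v k.
Proof.
move=> v0; have vmax : v \in F ord_max by rewrite flag_max memvf.
case: (@arg_minnP _ ord_max (fun m => v \in F m) (@nat_of_ord _) vmax) => m vm m_min.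
case: (unliftP ord0 m) => [k mE|mE]; last first.
  by move: vm; rewrite mE flag0 memv0 (negPf v0).
exists k; rewrite /jump -mE vm; apply/negP=> /m_min.
by rewrite mE lift_max lift0 ltnn.
Qed.

Lemma jumpZ (c : K) v k : c != 0 -> jump F (c *: v) k = jump F v k.
Proof. by move=> c0; rewrite /jump !rpredZeq (negPf c0). Qed.

(** The intersection grows by at most one dimension because F does, and it
    grows exactly when some vector of V enters F at this step. *)
Lemma dim_jump V (k : 'I_n) (b : bool) :
    reflect (exists2 v, v \in V & jump F v k) b ->
  \dim (V :&: F (lift ord0 k)) = (\dim (V :&: F (lift ord_max k)) + b)%N.
Proof.
move=> bP; have sF : (F (lift ord_max k) <= F (lift ord0 k))%VS.
  by apply: flagF.1; rewrite lift0 lift_max.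
have sVF : (V :&: F (lift ord_max k) <= V :&: F (lift ord0 k))%VS by rewrite capvS.
case: bP => [[v vV /andP[v1 v0]]|noV]; last first.
  rewrite addn0; apply/eqP; rewrite eq_sym (dimv_leqif_sup sVF).
  apply/subvP=> v; rewrite !memv_cap => /andP[vV v1].
  rewrite vV /=; apply/idPn=> v0; case: noV; exists v => //.
  by rewrite /jump v1.
apply/eqP; rewrite addn1 eqn_leq; apply/andP; split.
  set A := (V :&: F (lift ord0 k))%VS.
  have <- : (A :&: F (lift ord_max k) = V :&: F (lift ord_max k))%VS.
    by rewrite -capvA (capv_idPr sF).
  have : (\dim (A + F (lift ord_max k)) <= k.+1)%N.
    rewrite -(lift0 k) -flagF.2; apply: dimvS.
    by rewrite subv_add sF capvSr.
  have := dimv_sum_cap A (F (lift ord_max k)).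
  rewrite (flagF.2 (lift ord_max k)) lift_max => eqA leA.
  by rewrite -(leq_add2r k) -eqA addSnnS addnC leq_add2l.
rewrite ltn_neqAle (dimvS sVF) andbT (dimv_leqif_sup sVF).
apply: contra v0 => /subvP/(_ v); rewrite !memv_cap vV v1.
by move=> /(_ isT).
Qed.

(** The dimensions of the intersections of V with F go from 0 to dim V and
    increase by one at each jump. *)
Lemma card_jumps V (J : {set 'I_n}) :
  (forall k, reflect (exists2 v, v \in V & jump F v k) (k \in J)) ->
  #|J| = \dim V.
Proof.
move=> JP; pose f m := \dim (V :&: F (inord m)).
have f0 : f 0%N = 0%N.
  rewrite /f (_ : inord 0 = ord0) ?flag0 ?capv0 ?dimv0 //.
  by apply: ord_inj; rewrite inordK.
have -> : \dim V = f n.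
  rewrite /f (_ : inord n = ord_max) ?flag_max ?capvf //.
  by apply: ord_inj; rewrite inordK.
have fS (k : 'I_n) : f k.+1 = (f k + (k \in J))%N.
  rewrite /f (_ : inord k.+1 = lift ord0 k); last first.
    by apply: ord_inj; rewrite inordK ?lift0 ?ltnS.
  rewrite (_ : inord k = lift ord_max k) ?(dim_jump (JP k)) //.
  by apply: ord_inj; rewrite lift_max inordK // ltnS ltnW.
transitivity (f n - f 0)%N; last by rewrite f0 subn0.
rewrite -sum1_card big_mkcond -telescope_sumn_in //.
  rewrite big_mkord; apply: eq_bigr => k _.
  by rewrite fS addKn /=; case: (k \in J).
by move=> m /= lt_mn; rewrite (fS (Ordinal lt_mn)) leq_addr.
Qed.


End Jumps.

(** * The array of positions of nonzero vectors *)

Lemma in_bigcapv (K : fieldType) (V : vectType K) (I : finType)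
    (U : I -> {vspace V}) v :
  reflect (forall i, v \in U i) (v \in \bigcap_i U i)%VS.
Proof.
rewrite memvE; apply: (iffP subv_bigcapP) => [sU i|sU i _].
  by rewrite memvE sU.
by rewrite -memvE.
Qed.

Section VectorArray.

Variables (K : finFieldType) (n d : nat).
Variable E : 'I_d -> 'I_n.+1 -> {vspace 'rV[K]_n}.

(** A vector v with a jump at each x i is nonzero as soon as there is at least
    one flag, and each flag then determines x i from v. *)
Definition vector_array : {set position n d} :=
  [set x : position n d | [exists v, [forall i, jump (E i) v (x i)]]].

Hypothesis flagE : forall i, complete_flag (E i).

Lemma vector_arrayP (x : position n d) :
  reflect (exists v, forall i, jump (E i) v (x i)) (x \in vector_array).
Proof.
rewrite inE; apply: (iffP existsP) => [[v /forallP]|[v vx]]; exists v => //.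
exact/forallP.
Qed.

(** A vector has its position below x exactly when it lies in the intersection
    V of the subspaces indexed by x, so the j-th coordinates that occur are the
    jumps of the flag E j on V. *)
Lemma vector_array_rank x :
  has_rank (below vector_array x)
    (\dim (\bigcap_(i < d) E i (lift ord0 (x i)))%VS).
Proof.
move=> j; apply: (card_jumps (flagE j)) => k; rewrite inE.
apply: (iffP existsP) => [[y]|[v /in_bigcapv vx jvk]].
  rewrite inE => /andP[/andP[/vector_arrayP[v vy] /forallP le_yx] /eqP <-].
  exists v => //; apply/in_bigcapv => i; have /andP[vi _] := vy i.
  by apply: subvP vi; apply: (flagE i).1; rewrite !lift0 ltnS.
have /fin_all_exists [y vy] i : exists m, jump (E i) v m.
  exact: jump_exists (flagE i) _ (jump_neq0 jvk).
exists (finfun y); rewrite inE -andbA; apply/and3P; split.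
- by apply/vector_arrayP; exists v => i; rewrite ffunE.
- by apply/forallP=> i; rewrite ffunE (jump_le (flagE i) (vy i) (vx i)).
- by rewrite ffunE (jump_inj (flagE j) (vy j) jvk).
Qed.

Lemma vector_array_realized : realized_by vector_array E.
Proof. by split=> // x; apply: vector_array_rank. Qed.

End VectorArray.

(** If v spans E j 1, then its position x has the least possible j-th
    coordinate.  Every member of a set with join x shares that coordinate, so it
    is the position of a multiple of v, which is x itself: a join with more than
    one member is impossible. *)
Lemma vector_array_irredundant (K : finFieldType) (n d : nat)
    (E : 'I_d -> 'I_n.+2 -> {vspace 'rV[K]_n.+1}) :
    (forall i, complete_flag (E i)) ->
    (forall v, v != 0 -> exists i, v \in E i (lift ord0 ord0)) ->
  forall x, x \in vector_array E -> ~ redundant (vector_array E) x.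
Proof.
move=> flagE coverE x /vector_arrayP[v vx] [R [/subsetP sR xR R_gt1 _]].
suff /subset_leq_card : R \subset [set x] by rewrite cards1 leqNgt R_gt1.
apply/subsetP=> y Ry; rewrite inE; apply/eqP/ffunP.
have /vector_arrayP[u uy] := sR y Ry.
have [/card0_eq d0|/card_gt0P[i0 _]] := posnP #|'I_d|.
  by move=> i; have := d0 i; rewrite inE.
have [j vj] := coverE v (jump_neq0 (vx i0)).
have yj0 : y j = ord0.
  apply/ord_inj/eqP; rewrite -leqn0.
  apply: leq_trans (jump_le (flagE j) (vx j) vj).
  by rewrite xR (bigD1 y Ry) leq_maxl.
have /andP[] := uy j; rewrite yj0 => uj _.
have Ej : E j (lift ord0 ord0) = <[v]>%VS.
  apply/esym/eqP; rewrite eqEdim -memvE vj (flagE j).2 dim_vline.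
  by rewrite (jump_neq0 (vx j)).
move: uj; rewrite Ej => /vlineP[c uE] i.
have c0 : c != 0.
  by have := jump_neq0 (uy j); rewrite uE scaler_eq0 negb_or => /andP[].
have vy : jump (E i) v (y i) by rewrite -(jumpZ _ _ _ c0) -uE.
exact (jump_inj (flagE i) vy (vx i)).
Qed.

Lemma vector_array_permutation (K : finFieldType) (n d : nat)
    (E : 'I_d -> 'I_n.+2 -> {vspace 'rV[K]_n.+1}) :
    (forall i, complete_flag (E i)) ->
    (forall v, v != 0 -> exists i, v \in E i (lift ord0 ord0)) ->
  permutation_array (vector_array E).
Proof.
move=> flagE coverE; split; last exact: vector_array_irredundant.
  by move=> y; eexists; apply: vector_array_rank.
move=> j; have := vector_array_rank flagE [ffun=> ord_max] j.
rewrite big1 => [|i _]; last first.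
  by rewrite ffunE -(flag_max (flagE i)); congr (E i _); apply: ord_inj.
rewrite dimvf /dim /= mul1n; apply: etrans; congr rk_coord; apply/setP=> x.
rewrite !inE; case: existsP => //= _; apply/esym/forallP=> i.
by rewrite ffunE -ltnS ltn_ord.
Qed.

(** The array determines the relative position of any two flags that realize
    it, since the coordinates equal to ord_max impose no condition. *)
Lemma realized_dim_pair (K : fieldType) (n d : nat) (P : {set position n.+1 d})
    (E : 'I_d -> 'I_n.+2 -> {vspace 'rV[K]_n.+1}) (i j : 'I_d) (a b : 'I_n.+1) :
    realized_by P E -> i != j ->
  has_rank (below P [ffun k => if k == i then a else if k == j then b else ord_max])
    (\dim (E i (lift ord0 a) :&: E j (lift ord0 b))%VS).
Proof.
move=> [flagE rkE] neq_ij; set x := finfun _.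
suff -> : (E i (lift ord0 a) :&: E j (lift ord0 b) =
           \bigcap_(k < d) E k (lift ord0 (x k)))%VS by apply: rkE.
apply/vspaceP=> v; rewrite memv_cap; apply/andP/in_bigcapv=> [[vi vj] k|vE]; last first.
  have := vE i; have := vE j.
  by rewrite !ffunE !eqxx eq_sym (negPf neq_ij).
rewrite ffunE; case: eqP => [->//|_]; case: eqP => [->//|_].
rewrite (_ : lift _ _ = ord_max) ?(flag_max (flagE k)) ?memvf //.
exact: ord_inj.
Qed.

(** * Fano configurations have characteristic 2 *)

Section FanoConfiguration.

(** {0, 1, 3} is a perfect difference set mod 7: each nonzero residue is the
    difference of exactly one pair.  Its translates are the lines of the Fano
    plane; fano_inc i j says that the point j is on the line i. *)
Definition fano_inc (i j : 'I_7) : bool := j \in [:: i; i + 1; i + 3].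

Lemma fano_inc_refl i : fano_inc i i.
Proof. exact: mem_head. Qed.

(** Turns statements about all pairs of indices mod 7 into computations on
    natural numbers. *)
Lemma all_ord7 (P : rel nat) :
  all (fun i => all (P i) (iota 0 7)) (iota 0 7) -> forall i j : 'I_7, P i j.
Proof.
have mem7 (i : 'I_7) : nat_of_ord i \in iota 0 7 by rewrite mem_iota leq0n ltn_ord.
by move=> /allP P7 i j; apply: (allP (P7 i (mem7 i))); apply: mem7.
Qed.

(** The nonzero elements 1 and 3 of the difference set have opposites 6 and 4,
    outside of it.  With reflexivity, this makes both points and lines of a
    configuration pairwise distinct. *)
Lemma fano_inc_anti i j : fano_inc i j -> fano_inc j i -> i = j.
Proof.
move=> ij ji; apply/ord_inj/eqP; move: i j ij ji.
pose P (i j : nat) := (j \in [:: i; (i + 1) %% 7; (i + 3) %% 7]%N) ==>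
  (i \in [:: j; (j + 1) %% 7; (j + 3) %% 7]%N) ==> (i == j).
move=> i j ij ji; have /implyP/(_ ij)/implyP/(_ ji) // : P i j.
exact: all_ord7.
Qed.

Lemma dim_capv_sub (K : fieldType) (V : vectType K) (U W : {vspace V}) :
  (U <= W)%VS = (\dim (U :&: W) == \dim U).
Proof. by rewrite (dimv_leqif_eq (capvSl U W)) (sameP capv_idPl eqP). Qed.

Lemma dim_capv_lt (K : fieldType) (V : vectType K) (U W : {vspace V}) :
  \dim U = \dim W -> U != W -> (\dim (U :&: W) < \dim U)%N.
Proof.
move=> dimUW neqUW; rewrite ltn_neqAle (dimvS (capvSl _ _)) andbT.
rewrite (dimv_leqif_sup (capvSl _ _)) subv_cap subvv /=.
by apply: contra neqUW => sUW; rewrite eqEdim sUW dimUW /=.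
Qed.

Variables (K : fieldType) (V : vectType K) (A L : 'I_7 -> {vspace V}).
Hypothesis dimA : forall i, \dim (A i) = 1%N.
Hypothesis dimL : forall i, \dim (L i) = 2%N.
Hypothesis incAL : forall i j, (A j <= L i)%VS = fano_inc i j.

Lemma fano_points_disjoint i j : i != j -> (A i :&: A j = 0)%VS.
Proof.
move=> neq_ij; apply/eqP; rewrite -dimv_eq0 -leqn0 -ltnS -(dimA i).
apply: dim_capv_lt; rewrite ?dimA //; apply: contra neq_ij => /eqP eqA.
apply/eqP/fano_inc_anti; rewrite -incAL; first by rewrite -eqA incAL fano_inc_refl.
by rewrite eqA incAL fano_inc_refl.
Qed.

Lemma fano_lines_meet i j k v : i != j -> fano_inc i k -> fano_inc j k ->
  v \in L i -> v \in L j -> v \in A k.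
Proof.
move=> neq_ij ik jk vi vj.
suff -> : A k = (L i :&: L j)%VS by rewrite memv_cap vi.
apply/eqP; rewrite eqEdim subv_cap !incAL ik jk dimA /= -ltnS -(dimL i).
apply: dim_capv_lt; rewrite ?dimL //; apply: contra neq_ij => /eqP eqL.
apply/eqP/fano_inc_anti; rewrite -incAL; first by rewrite eqL incAL fano_inc_refl.
by rewrite -eqL incAL fano_inc_refl.
Qed.

Lemma fano_line_sum i j k : j != k -> fano_inc i j -> fano_inc i k ->
  (A j + A k = L i)%VS.
Proof.
move=> neq_jk ij ik; apply/eqP; rewrite eqEdim subv_add !incAL ij ik.
by rewrite dimL dimv_disjoint_sum ?dimA ?fano_points_disjoint.
Qed.

(** Let each wi be in A i.  Split a nonzero w3 along the points 0 and 1 of the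
    line 0 as w0 + w1, then w1 along the points 4 and 2 of the line 1 as w4 + w2;
    w0 is not zero because A 3 and A 1 are disjoint.  The point 6 is the intersection of the lines 3 and 6, which contain w3 - w4 = w0 + w2.
    The point 5 is the intersection of the lines 2 and 4, which contain
    w3 - w2 = w0 + w4.  The line 5 through the points 5, 6 and 1 contains
    (w0 + w4) - w1 = w0 - w2, which is also on the line 6, hence in the point 6.
    So 2 w0 is in A 6 as well as in A 0. *)
Lemma fano_char2 : 2 \in [pchar K].
Proof.
have inL i j v : fano_inc i j -> v \in A j -> v \in L i.
  by rewrite -incAL => /subvP; apply.
have [w3 w3A w30] : exists2 w, w \in A 3 & w != 0.
  by exists (vpick (A 3)); rewrite ?memv_pick // vpick0 -dimv_eq0 dimA.
have /memv_addP[w0 w0A [w1 w1A w3E]] : w3 \in (A 0%R + A 1%R)%VS.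
  by rewrite (@fano_line_sum 0 0 1) //; apply: inL w3A.
have w00 : w0 != 0.
  apply: contraNneq w30 => w00; rewrite -memv0.
  rewrite -(@fano_points_disjoint 1 3) // memv_cap w3A andbT.
  by rewrite w3E w00 add0r.
have /memv_addP[w4 w4A [w2 w2A w1E]] : w1 \in (A 4%R + A 2%R)%VS.
  by rewrite (@fano_line_sum 1 4 2) //; apply: inL w1A.
have w6A : w0 + w2 \in A 6.
  apply: (@fano_lines_meet 6 3) => //.
    by rewrite rpredD //; [apply: inL w0A | apply: inL w2A].
  have -> : w0 + w2 = w3 - w4 by rewrite w3E w1E addrA addrAC addrK.
  by rewrite rpredB //; [apply: inL w3A | apply: inL w4A].
have w5A : w0 + w4 \in A 5.
  apply: (@fano_lines_meet 4 2) => //.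
    by rewrite rpredD //; [apply: inL w0A | apply: inL w4A].
  have -> : w0 + w4 = w3 - w2 by rewrite w3E w1E addrA addrK.
  by rewrite rpredB //; [apply: inL w3A | apply: inL w2A].
have w6A' : w0 - w2 \in A 6.
  apply: (@fano_lines_meet 6 5) => //.
    by rewrite rpredB //; [apply: inL w0A | apply: inL w2A].
  have -> : w0 - w2 = w0 + w4 - w1 by rewrite w1E opprD addrA addrK.
  by rewrite rpredB //; [apply: inL w5A | apply: inL w1A].
have : w0 *+ 2 \in (A 0%R :&: A 6%R)%VS.
  have w02 : w0 *+ 2 = w0 + w2 + (w0 - w2).
    by rewrite addrACA subrr addr0 mulr2n.
  by rewrite memv_cap rpredMn // w02 rpredD.
rewrite fano_points_disjoint // memv0 -scaler_nat scaler_eq0 (negPf w00) orbF.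
by rewrite inE.
Qed.

End FanoConfiguration.

(** * The Fano plane over F_2 *)

(** The successive powers of a root of X^3 + X + 1 in F_8, as binary numbers:
    the bit k is the coefficient of X^k. *)
Definition fano_code : seq nat := [:: 1; 2; 4; 3; 6; 7; 5].

Definition fano_bit (i k : nat) : bool := odd (nth 0 fano_code i %/ 2 ^ k).

Definition fano_point (i : 'I_7) : 'rV['F_2]_3 := \row_k (fano_bit i k)%:R.

Lemma F2_cases (c : 'F_2) : c = 0 \/ c = 1.
Proof. by case: c => [[|[|]]] // ?; [left | right]; apply: val_inj. Qed.

Lemma F2_bool_inj (a b : bool) : a%:R = b%:R :> 'F_2 -> a = b.
Proof. by case: a b => [[]|[]]. Qed.

Lemma F2_addb (a b : bool) : (a (+) b)%:R = a%:R + b%:R :> 'F_2.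
Proof. by case: a b => [[]|[]]; apply: val_inj. Qed.

Lemma fano_point_inj : injective fano_point.
Proof.
pose P (i j : nat) :=
  all (fun k => fano_bit i k == fano_bit j k) (iota 0 3) ==> (i == j).
move=> i j /rowP eq_ij; apply/ord_inj/eqP.
have /implyP : P i j by apply: all_ord7.
apply; apply/allP=> k; rewrite mem_iota => /= lt_k3.
by have := eq_ij (Ordinal lt_k3); rewrite !mxE => /F2_bool_inj ->.
Qed.

Lemma fano_point_neq0 i : fano_point i != 0.
Proof.
pose P (i j : nat) := has (fano_bit i) (iota 0 3).
have /hasP[k] : P i i by apply: (@all_ord7 P).
rewrite mem_iota => /= lt_k3 ik; apply/eqP=> /rowP p0.
by have /eqP := p0 (Ordinal lt_k3); rewrite !mxE ik.
Qed.

(** The relation 1 + a = a^3, multiplied by a^i. *)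
Lemma fano_point_sum i : fano_point i + fano_point (i + 1) = fano_point (i + 3).
Proof.
pose P (i j : nat) := all (fun k => fano_bit ((i + 3) %% 7)%N k ==
  fano_bit i k (+) fano_bit ((i + 1) %% 7)%N k) (iota 0 3).
have /allP bits : P i i by apply: (@all_ord7 P).
apply/rowP=> k; have kin : nat_of_ord k \in iota 0 3 by rewrite mem_iota leq0n ltn_ord.
have bit3 : fano_bit (i + 3)%R k = fano_bit i k (+) fano_bit (i + 1)%R k.
  exact/eqP/(bits _ kin).
by rewrite !mxE bit3 F2_addb.
Qed.

(** Seven distinct nonzero vectors exhaust a space with eight elements. *)
Lemma fano_point_surj v : v != 0 -> exists i, v = fano_point i.
Proof.
move=> v0; suff /imsetP[i _ ->] : v \in fano_point @: setT by exists i.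
suff -> : fano_point @: setT = [set~ 0] by rewrite !inE.
apply/eqP; rewrite eqEcard; apply/andP; split.
  by apply/subsetP=> _ /imsetP[i _ ->]; rewrite !inE fano_point_neq0.
by rewrite card_imset ?cardsT ?cardsC1 ?card_mx ?card_ord //; apply: fano_point_inj.
Qed.

Lemma fano_lineE i j :
  (fano_point j \in <<[:: fano_point i; fano_point (i + 1)%R]>>%VS) = fano_inc i j.
Proof.
rewrite span_cons span_seq1; apply/memv_addP/idP => [[_ /vlineP[a ->]]|].
  case=> _ /vlineP[b ->]; have p0 := negPf (fano_point_neq0 j).
  case: (F2_cases a) (F2_cases b) => -> [] ->;
    rewrite ?scale0r ?scale1r ?addr0 ?add0r ?fano_point_sum;
    first by move=> /eqP; rewrite p0.
  - by move/fano_point_inj->; rewrite /fano_inc !inE eqxx orbT.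
  - by move/fano_point_inj->; rewrite /fano_inc !inE eqxx.
  - by move/fano_point_inj->; rewrite /fano_inc !inE eqxx !orbT.
rewrite /fano_inc !inE => /or3P[] /eqP->.
- by exists (fano_point i); rewrite ?memv_line //; exists 0; rewrite ?mem0v ?addr0.
- by exists 0; rewrite ?mem0v //; exists (fano_point (i + 1));
    rewrite ?memv_line ?add0r.
exists (fano_point i); rewrite ?memv_line //.
by exists (fano_point (i + 1)); rewrite ?memv_line ?fano_point_sum.
Qed.

(** The third vector only completes the flag to the whole space. *)
Definition fano_basis (i : 'I_7) :=
  [:: fano_point i; fano_point (i + 1); fano_point (i + 2)].

Definition fano_flag (i : 'I_7) (m : 'I_4) : {vspace 'rV['F_2]_3} :=
  <<take m (fano_basis i)>>%VS.

Lemma fano_inc_succ i : ~~ fano_inc (i + 1) i.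
Proof.
apply/negP=> inc1; have inc2 : fano_inc i (i + 1) by rewrite /fano_inc !inE eqxx orbT.
by have /eqP := fano_inc_anti inc2 inc1; rewrite eq_sym addrC -subr_eq0 addrK.
Qed.

(** Each vector is outside the span of the following ones because the point i
    is not on the line i + 1. *)
Lemma fano_basis_free i : free (fano_basis i).
Proof.
have i2 : i + 2 = i + 1 + 1 by rewrite -addrA.
rewrite /fano_basis i2 !free_cons fano_lineE fano_inc_succ nil_free span_nil.
rewrite memv0 fano_point_neq0 /= andbT; apply: contra (fano_inc_succ (i + 1)).
by rewrite -fano_lineE span_seq1 span_cons; apply: (subvP (addvSl _ _)).
Qed.

Lemma span_take_flag (K : fieldType) (n : nat) (X : seq 'rV[K]_n) :
  free X -> size X = n -> complete_flag (fun m : 'I_n.+1 => <<take m X>>%VS).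
Proof.
move=> freeX sizeX; split=> [i j le_ij|i].
  by apply: sub_span => v; rewrite -(subnKC le_ij) takeD mem_cat => ->.
have := freeX; rewrite -{1}(cat_take_drop i X) => /catl_free/eqP ->.
by rewrite size_takel // sizeX -ltnS.
Qed.

Lemma fano_flag_complete i : complete_flag (fano_flag i).
Proof. exact: span_take_flag (fano_basis_free i) _. Qed.

Lemma fano_flag_incE i j :
  (fano_flag j (lift ord0 ord0) <= fano_flag i (lift ord0 1))%VS = fano_inc i j.
Proof. by rewrite -fano_lineE memvE /fano_flag /= span_seq1. Qed.

(** * The array and its realizations *)

Definition fano_array : {set position 3 7} := vector_array fano_flag.

Lemma fano_array_realized : realized_by fano_array fano_flag.
Proof. exact: vector_array_realized fano_flag_complete. Qed.

Lemma fano_array_permutation : permutation_array fano_array.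
Proof.
apply: vector_array_permutation fano_flag_complete _ => v.
by move=> /fano_point_surj[i ->]; exists i; rewrite memv_span ?mem_head.
Qed.

(** Incidence of A j and L i is read off the dimension of their intersection,
    which the array prescribes, except when i = j, where the flag gives it. *)
Lemma fano_array_char2 (K : fieldType) : realizable K fano_array -> 2 \in [pchar K].
Proof.
case=> E realE; have flagE := realE.1.
apply: (@fano_char2 K _ (fun i => E i (lift ord0 ord0))
                        (fun i => E i (lift ord0 1))) => [i|i|i j].
- exact: (flagE i).2.
- exact: (flagE i).2.
rewrite -fano_flag_incE; have [->|neq_ij] := eqVneq i j.
  by rewrite fano_flag_incE fano_inc_refl (flagE j).1.
rewrite !dim_capv_sub (flagE j).2 (fano_flag_complete j).2.
rewrite eq_sym in neq_ij.
rewrite -(realized_dim_pair ord0 1 realE neq_ij i).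
by rewrite -(realized_dim_pair ord0 1 fano_array_realized neq_ij i).
Qed.

Theorem mainTheorem5 :
  exists P : {set position 3 7},
    [/\ permutation_array P,
        realizable 'F_2 P,
        forall K : fieldType, 2%N \notin [pchar K]%R -> ~ realizable K P
      & forall R : realType, ~ realizable (complex R) P].
Proof.
exists fano_array; split.
- exact: fano_array_permutation.
- by exists fano_flag; apply: fano_array_realized.
- by move=> K charK /fano_array_char2; apply/negP.
- by move=> R /fano_array_char2; rewrite pchar_num.
Qed.
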